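(* Let $r\ge 2$ and let $\mathcal F$ be a blowup-invariant family of $r$-graphs. Let $\mathfrak H$ denote the class of all symmetrized $\mathcal F$-free $r$-graphs, and for $n\in\mathbb N$ set $\mathfrak h(n)=\max\{|\mathcal H| : \mathcal H\in\mathfrak H \text{ and } v(\mathcal H)=n\}$. Then $\mathrm{ex}(n,\mathcal F)=\mathfrak h(n)$ holds for every $n\in\mathbb N$.
   Context: An $r$-graph is a finite $r$-uniform hypergraph $\mathcal H$, identified with its edge set, with vertex set $V(\mathcal H)$; $v(\mathcal H)=|V(\mathcal H)|$ and $|\mathcal H|$ is the number of edges. $\mathcal H$ is $\mathcal F$-free if it contains no member of $\mathcal F$ as a (not necessarily induced) subgraph, and $\mathrm{ex}(n,\mathcal F)$ is the maximum number of edges of an $\mathcal F$-free $r$-graph on $n$ vertices. A homomorphism from an $r$-graph $F$ to an $r$-graph $\mathcal H$ is a map $\phi\colon V(F)\to V(\mathcal H)$ with $\phi(E)\in\mathcal H$ for all $E\in F$. $\mathcal H$ is $\mathcal F$-hom-free if for no $F\in\mathcal F$ there is a homomorphism from $F$ to $\mathcal H$. The family $\mathcal F$ is blowup-invariant if every $\mathcal F$-free $r$-graph is $\mathcal F$-hom-free as well. The link of $v\in V(\mathcal H)$ is $L_{\mathcal H}(v)=\{A\in\binom{V(\mathcal H)}{r-1} : A\cup\{v\}\in\mathcal H\}$. Two vertices are equivalent if they have the same link. $\mathcal H$ is symmetrized if for any two non-equivalent vertices $u,v\in V(\mathcal H)$ there is an edge of $\mathcal H$ containing both $u$ and $v$.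 *)

(* Defs.v *)
From mathcomp Require Import all_boot.
From mathcomp Require Import boolp classical_sets.

Set Implicit Arguments.
Unset Strict Implicit.
Unset Printing Implicit Defensive.

Local Open Scope classical_set_scope.

Record unif_hypergraph (r : nat) := UnifHypergraph {
  vertices : finType;
  edges : {set {set vertices}};
  edges_uniform : forall e, e \in edges -> #|e| = r
}.

Definition num_vertices (r : nat) (H : unif_hypergraph r) : nat := #|vertices H|.

Definition num_edges (r : nat) (H : unif_hypergraph r) : nat := #|edges H|.

Definition is_hom (r : nat) (F H : unif_hypergraph r) (phi : vertices F -> vertices H) : Prop :=
  forall e : {set vertices F}, e \in edges F -> phi @: e \in edges H.

(* An injective homomorphism exhibits F, up to isomorphism, as a (not
   necessarily induced) subgraph of H. *)
Definition has_copy (r : nat) (F H : unif_hypergraph r) : Prop :=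
  exists2 phi : vertices F -> vertices H, injective phi & is_hom phi.

Definition family_free (r : nat) (FF : unif_hypergraph r -> Prop) (H : unif_hypergraph r) : Prop :=
  forall F, FF F -> ~ has_copy F H.

Definition family_hom_free (r : nat) (FF : unif_hypergraph r -> Prop) (H : unif_hypergraph r) : Prop :=
  forall F, FF F -> ~ (exists phi : vertices F -> vertices H, is_hom phi).

Definition blowup_invariant (r : nat) (FF : unif_hypergraph r -> Prop) : Prop :=
  forall H : unif_hypergraph r, family_free FF H -> family_hom_free FF H.

Definition link (r : nat) (H : unif_hypergraph r) (v : vertices H) : {set {set vertices H}} :=
  [set A : {set vertices H} | (#|A| == r.-1) && (v |: A \in edges H)]%SET.

Definition link_equiv (r : nat) (H : unif_hypergraph r) (u v : vertices H) : Prop :=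
  link u = link v.

Definition symmetrized (r : nat) (H : unif_hypergraph r) : Prop :=
  forall u v : vertices H, ~ link_equiv u v ->
    exists2 e, e \in edges H & (u \in e) && (v \in e).

Definition is_max_edges (r : nat) (C : unif_hypergraph r -> Prop) (n m : nat) : Prop :=
  (exists H, [/\ C H, num_vertices H = n & num_edges H = m]) /\
  (forall H, C H -> num_vertices H = n -> num_edges H <= m).

(* The value is None exactly when C has no member on n vertices, since the
   maximum is then over the empty set; for C the F-free r-graphs this can happen
   only if F has an edgeless member. *)
Definition max_edges (r : nat) (C : unif_hypergraph r -> Prop) (n : nat) : option nat :=
  xget None [set o | exists2 m, is_max_edges C n m & o = Some m].

Definition ex_num (r : nat) (n : nat) (FF : unif_hypergraph r -> Prop) : option nat :=
  max_edges (family_free FF) n.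

Definition symm_free (r : nat) (FF : unif_hypergraph r -> Prop) (H : unif_hypergraph r) : Prop :=
  symmetrized H /\ family_free FF H.

Definition h_symm (r : nat) (FF : unif_hypergraph r -> Prop) (n : nat) : option nat :=
  max_edges (symm_free FF) n.

(* Main.v *)
Require Import Defs.
From mathcomp Require Import all_boot.
From mathcomp Require Import zify.
From mathcomp Require Import boolp.

(** Blow-ups of an F-free hypergraph H along maps f : V(H) -> V(H) stay F-free,
    by blowup-invariance.  Among all these maps choose one whose blow-up has the
    most edges and, subject to this, with the largest sum of the ranks of the
    values f z in a fixed enumeration of V(H).  If x and y lie in no common edge
    of the blow-up, redirecting x to f y replaces the edges at x by copies of the
    edges at y.  Doing this in both directions shows that x and y have the same
    degree, and the tie-break then forces f x = f y, so x and y are equivalent. *)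

(** When [E] is [r]-uniform, the cardinality condition makes [f] injective on [e]: an edge takes at
    most one vertex from each fibre of [f]. *)
Definition blowup_edges (T U : finType) (r : nat) (E : {set {set U}})
    (f : {ffun T -> U}) : {set {set T}} :=
  [set e : {set T} | (#|e| == r) && (f @: e \in E)].

Definition edges_at {T : finType} (E : {set {set T}}) (x : T) : {set {set T}} :=
  [set e in E | x \in e].

Definition redirect {T U : finType} (f : {ffun T -> U}) (x y : T) : {ffun T -> U} :=
  [ffun z => if z == x then f y else f z].

Lemma blowup_edges_uniform (T U : finType) (r : nat) (E : {set {set U}})
    (f : {ffun T -> U}) (e : {set T}) :
  e \in blowup_edges T U r E f -> #|e| = r.
Proof. by rewrite inE => /andP[/eqP]. Qed.

Definition blowup {r : nat} (H : unif_hypergraph r) (T : finType)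
    (f : {ffun T -> vertices H}) : unif_hypergraph r :=
  UnifHypergraph (@blowup_edges_uniform T (vertices H) r (edges H) f).

(** Composing a copy of [F] in the blow-up with [f] may lose injectivity but still gives a
    homomorphism into [H], which blowup-invariance excludes. *)
Lemma blowup_free (r : nat) (FF : unif_hypergraph r -> Prop) (H : unif_hypergraph r)
    (T : finType) (f : {ffun T -> vertices H}) :
  blowup_invariant FF -> family_free FF H -> family_free FF (blowup H T f).
Proof.
move=> hFF hH F FF_F [phi _ hom_phi]; apply: (hFF H hH F FF_F).
exists (f \o phi) => e eF; rewrite imset_comp.
by have := hom_phi e eF; rewrite inE => /andP[].
Qed.

Lemma imset_redirect (T U : finType) (f : {ffun T -> U}) (x y : T) (A : {set T}) :
  x \notin A -> redirect f x y @: A = f @: A.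
Proof.
move=> xA; apply: eq_in_imset => z zA; rewrite ffunE.
by case: eqP => // zx; rewrite -zx zA in xA.
Qed.

(** Edges avoiding [x] survive the redirection, and each edge at [y] yields a further one with [y]
    exchanged for [x]. The additive form avoids truncated subtraction. *)
Lemma card_blowup_redirect (T U : finType) (r : nat) (E : {set {set U}})
    (f : {ffun T -> U}) (x y : T) (B := blowup_edges T U r E) :
    (forall e, e \in B f -> ~~ ((x \in e) && (y \in e))) ->
  #|B f| + #|edges_at (B f) y| <= #|B (redirect f x y)| + #|edges_at (B f) x|.
Proof.
move=> uncov.
pose swap (e : {set T}) := x |: (e :\ y).
have at_y e : e \in edges_at (B f) y -> [/\ e \in B f, y \in e & x \notin e].
  rewrite inE => /andP[eB ye]; split=> //.
  by have := uncov e eB; rewrite ye andbT.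
have swap_inj : {in edges_at (B f) y &, injective swap}.
  apply: (@can_in_inj _ _ _ _ (fun e => y |: (e :\ x))) => e /at_y[_ ye xe].
  by rewrite /swap setU1K ?setD1K // !inE (negPf xe) andbF.
pose C := [set e in B f | x \notin e].
have cardB : #|B f| = #|edges_at (B f) x| + #|C|.
  rewrite -(cardsID [set e : {set T} | x \in e] (B f)); congr (_ + _);
    by apply: eq_card => e; rewrite !inE // andbC.
have disj : [disjoint C & swap @: edges_at (B f) y].
  apply/pred0P => e /=; apply/negP => /andP[]; rewrite inE => /andP[_ xe].
  by case/imsetP => e' _ e_eq; rewrite e_eq !inE eqxx in xe.
have sub : C :|: swap @: edges_at (B f) y \subset B (redirect f x y).
  apply/subsetP => e; rewrite inE => /orP[|/imsetP[e' /at_y[]]].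
    by rewrite !inE => /andP[eB xe]; rewrite imset_redirect.
  rewrite inE => /andP[/eqP card_e' e'E] ye xe ->.
  have xD : x \notin e' :\ y by rewrite !inE (negPf xe) andbF.
  (* Since [x] is now sent to [f y], the swapped edge has the same image as [e']. *)
  rewrite inE /swap cardsU1 xD imsetU1 imset_redirect // ffunE eqxx.
  by rewrite -imsetU1 setD1K // e'E andbT -card_e' (cardsD1 y e') ye.
have := subset_leq_card sub.
rewrite cardsU disjoint_setI0 // cards0 subn0 (card_in_imset swap_inj).
lia.
Qed.

Lemma blowup_link_eq (r : nat) (H : unif_hypergraph r) (T : finType)
    (f : {ffun T -> vertices H}) (x y : T) :
  0 < r -> f x = f y -> @link _ (blowup H T f) x = @link _ (blowup H T f) y.
Proof.
move=> r_gt0.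
suff sub u v : f u = f v ->
    @link _ (blowup H T f) u \subset @link _ (blowup H T f) v.
  by move=> fxy; apply/eqP; rewrite eqEsubset !sub.
move=> fuv; apply/subsetP => A; rewrite !inE /= => /and3P[cardA _].
rewrite cardA !imsetU1 fuv => fE; rewrite fE andbT.
(* The case [v \in A] has to be excluded: [v |: A] has at least [r] elements because its image is an
   edge, and at most [r] because [A] has [r.-1]. *)
have := edges_uniform fE; rewrite -imsetU1 => card_fA.
have := leq_imset_card f (v |: A); rewrite card_fA eqn_leq => ->; rewrite andbT.
by rewrite cardsU1 (eqP cardA); case: (_ \notin _) => /=; lia.
Qed.

Lemma sum_redirect (T U : finType) (f : {ffun T -> U}) (x y : T) (w : U -> nat) :
  \sum_z w (redirect f x y z) + w (f x) = \sum_z w (f z) + w (f y).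
Proof.
rewrite (bigD1 x) //= [\sum_z w (f z)](bigD1 x) //= ffunE eqxx.
have -> : \sum_(z | z != x) w (redirect f x y z) = \sum_(z | z != x) w (f z).
  by apply: eq_bigr => z /negPf zx; rewrite ffunE zx.
lia.
Qed.

Lemma exists_symmetrized_blowup (r : nat) (H : unif_hypergraph r) : 0 < r ->
  exists f : {ffun vertices H -> vertices H},
    symmetrized (blowup H _ f) /\ num_edges H <= num_edges (blowup H _ f).
Proof.
move=> r_gt0; set V := vertices H.
pose B := blowup_edges V V r (edges H).
pose w (z : V) : nat := enum_rank z.
pose id0 : {ffun V -> V} := [ffun z => z].
case: (@arg_maxnP _ id0 xpredT (fun f => #|B f|)) => // f0 _ f0_max.
case: (@arg_maxnP _ f0 (fun f => #|B f| == #|B f0|)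
  (fun f => \sum_z w (f z))) => //= f /eqP f_f0 f_max.
have edges_max g : #|B g| <= #|B f| by rewrite f_f0; apply: f0_max.
exists f; split; last first.
  (* The blow-up along the identity contains every edge of [H]. *)
  apply: leq_trans (edges_max id0); apply/subset_leq_card/subsetP => e eE.
  rewrite inE (edges_uniform eE) eqxx (_ : id0 @: e = e) //.
  by rewrite -[RHS]imset_id; apply: eq_imset => z; rewrite ffunE.
move=> x y nequiv; apply: contrapT => uncov; apply: nequiv.
pose uncovered u v := forall e, e \in B f -> ~~ ((u \in e) && (v \in e)).
have xy : uncovered x y by move=> e eB; apply/negP => xye; apply: uncov; exists e.
have yx : uncovered y x by move=> e /xy; rewrite andbC.
have deg_le u v : uncovered u v -> #|edges_at (B f) v| <= #|edges_at (B f) u|.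
  move=> /card_blowup_redirect; have := edges_max (redirect f u v).
  rewrite -/B; lia.
have w_le u v : uncovered u v -> uncovered v u -> w (f v) <= w (f u).
  (* As the degrees agree, redirecting keeps the edge count maximal, so the tie-break applies to
     [redirect f u v]. *)
  move=> uv vu; have B_redirect : #|B (redirect f u v)| == #|B f0|.
    rewrite -f_f0 eqn_leq edges_max -(leq_add2r #|edges_at (B f) v|).
    apply: leq_trans (card_blowup_redirect _ _ _ _ _ _ _ uv) _.
    by rewrite leq_add2l deg_le.
  have := f_max _ B_redirect; have := sum_redirect _ _ f u v w; lia.
(* Ranks are injective, so the two inequalities between them give [f x = f y]. *)
apply: blowup_link_eq => //; apply/enum_rank_inj/val_inj/eqP.
by rewrite eqn_leq [X in X && _]w_le ?[X in _ && X]w_le.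
Qed.

Theorem theorem1p4 (r : nat) (hr : 2 <= r) (FF : unif_hypergraph r -> Prop)
    (hFF : blowup_invariant FF) (n : nat) :
  ex_num n FF = h_symm FF n.
Proof.
have improve H : family_free FF H -> exists H', [/\ symm_free FF H',
    num_vertices H' = num_vertices H & num_edges H <= num_edges H'].
  move=> hH; have [f [sym le]] := @exists_symmetrized_blowup r H (ltnW hr).
  by exists (blowup H _ f); split=> //; split=> //; apply: blowup_free.
(* Equality of the predicates also covers the case without a maximum, where both sides are
   [None]. *)
suff is_max_eq : is_max_edges (family_free FF) n = is_max_edges (symm_free FF) n.
  by rewrite /ex_num /h_symm /max_edges is_max_eq.
apply/funext => m; apply/propext; split=> -[[H [CH vH eH]] H_max]; split.
- have [H' [CH' vH' le]] := improve H CH; exists H'.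
  have vn : num_vertices H' = n by rewrite vH'.
  split=> //; apply/eqP; rewrite eqn_leq -{2}eH le andbT.
  by apply: H_max => //; case: CH'.
- by move=> G [_ CG]; apply: H_max.
- by exists H; split=> //; case: CH.
- move=> G /improve[G' [CG' vG' le]] vG; apply: leq_trans le _.
  by apply: H_max; rewrite // vG'.
Qed.
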